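(* Each countably pracompact $k$-space $X$ is totally countably pracompact.
   Context: Let $X$ be a topological space. - $X$ is a $k$-space if $X$ is Hausdorff and a subset $F\subset X$ is closed in $X$ if and only if $F\cap K$ is closed in $K$ for every compact subspace $K\subset X$. - $X$ is countably pracompact if there exists a dense subset $D$ of $X$ such that every infinite subset $B\subseteq D$ has an accumulation point in $X$. - $X$ is totally countably pracompact if it contains a dense subset $D$ such that each sequence of points of $D$ has a subsequence whose set of terms has compact closure in $X$. *)

(* Defs.v *)
From HB Require Import structures.
From mathcomp Require Import all_boot all_order all_algebra.
From mathcomp Require Import all_classical all_reals all_analysis.

Set Implicit Arguments.
Unset Strict Implicit.
Unset Printing Implicit Defensive.

Local Open Scope classical_set_scope.

(* [set (subspace K)] carries the subspace topology of K on K and makes every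
   point outside K isolated, so for a subset of K being closed there is the
   same as being closed in the subspace K; cf. [closed_subspaceP]. *)
Definition k_space (X : topologicalType) : Prop :=
  hausdorff_space X /\
  forall F : set X,
    closed F <->
    (forall K : set X, compact K -> closed (F `&` K : set (subspace K))).

Definition countably_pracompact (X : topologicalType) : Prop :=
  exists D : set X,
    dense D /\
    (forall B : set X, B `<=` D -> infinite_set B -> limit_point B !=set0).

(* A subsequence of u is u \o phi with phi strictly increasing. *)
Definition totally_countably_pracompact (X : topologicalType) : Prop :=
  exists D : set X,
    dense D /\
    (forall u : nat -> X, (forall n, D (u n)) ->
      exists phi : nat -> nat,
        {homo phi : m n / (m < n)%N} /\ compact (closure (range (u \o phi)))).

(* Main.v *)
(** If a sequence [u] in [D] has infinite range, the range has an accumulation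
    point [x], so [range u `\ x] is not closed.  As [X] is a k-space, some
    compact [K] meets [range u `\ x] in a set that is not closed in [K]; finite
    sets being closed, that trace is infinite, so [u] is in [K] infinitely
    often. *)
Require Import Defs.
From mathcomp Require Import all_boot all_order all_algebra.
From mathcomp Require Import all_classical all_reals all_analysis.

Set Implicit Arguments.

(** By contraposition: finite traces are compact, hence closed since [X] is Hausdorff. *)
Lemma k_space_compact_infinite_trace (X : topologicalType) (F : set X) :
  k_space X -> ~ closed F ->
  exists2 K : set X, compact K & infinite_set (F `&` K)%classic.
Proof.
move=> [hX kX] nF; apply: contrapT => noK; apply: nF; apply/kX => K cK.
apply/closed_subspaceP; exists (F `&` K)%classic => //.
apply: (compact_closed hX); apply: finite_compact.
by apply: contrapT => infFK; apply: noK; exists K.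
Qed.

(** Neighbourhoods of [x] meet [B] away from [x], so [x] is in the closure of the set it was removed
    from. *)
Lemma limit_point_not_closed (X : topologicalType) (B : set X) (x : X) :
  limit_point B x -> ~ closed (B `\ x)%classic.
Proof.
move=> Bx cB; suff [_] : (B `\ x)%classic x by apply.
apply: cB => U /Bx[y [/eqP yx By Uy]].
by exists y.
Qed.

Lemma compact_infinitely_often (X : topologicalType) (D : set X)
    (u : nat -> X) :
  k_space X ->
  (forall B : set X,
     (B `<=` D)%classic -> infinite_set B -> (limit_point B !=set0)%classic) ->
  (forall n, D (u n)) ->
  exists2 K : set X, compact K & infinite_set (u @^-1` K)%classic.
Proof.
move=> kX accD Du; have [finu|infu] := pselect (finite_set (range u)).
  (* A finite range serves as [K] itself: every index lands in it. *)
  exists (range u); first exact: finite_compact.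
  suff -> : (u @^-1` range u)%classic = setT by exact: infinite_nat.
  by apply/seteqP; split => // n _; exists n.
have [_ [n _ <-]|x ux] := accD (range u) _ infu; first exact: Du.
have [K cK infK] := k_space_compact_infinite_trace kX (limit_point_not_closed ux).
exists K => // finK; apply: infK.
(* The trace on [K] lies in the image under [u] of the indices landing in [K]. *)
apply: sub_finite_set (finite_image u finK) => _ [[[n _ <-] _] Kun].
by exists n.
Qed.

Theorem proposition3p3 (X : topologicalType) :
  k_space X -> countably_pracompact X -> totally_countably_pracompact X.
Proof.
move=> kX [D [dD accD]]; exists D; split => // u Du.
have [K cK infK] := compact_infinitely_often u kX accD Du.
have finle (m : nat) : finite_set [set n : nat | (n <= m)%O]%classic.
  by apply: sub_finite_set (finite_II m.+1).
have [phi [phi_mono _ Kphi]] := infinite_increasing_seq_wf finle infK 0%N.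
exists phi; split; first by move=> m n; rewrite -(leqW_mono phi_mono).
have clK := compact_closed kX.1 cK.
apply: (subclosed_compact (@closed_closure _ _) cK).
apply: subset_trans (clK); apply: closureS => _ [n _ <-]; exact: Kphi.
Qed.
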